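(* Let $f : \mathbb{R}^{n} \rightarrow (-\infty,\infty]$ be $K$-Lipschitz over $\mathrm{dom}(f)$, with $\mathrm{dom}(f)$ compact and with a unique minimizer $x^{\ast}$. Let $x_{0} \in \mathrm{dom}(f)$ with $x_{0} \ne x^{\ast}$, let $d_{0} = (x^{\ast} - x_{0})/\lVert x^{\ast} - x_{0} \rVert$, let $\alpha > 0$ be a step size, let $d \in \mathbb{R}^{n}$, and let $x_{m} = x_{0} + m \alpha d$ for $m = 0,1,2,\ldots$. If $m = \left\lfloor \lVert x^{\ast} - x_{0} \rVert / \alpha \right\rfloor$ and $x_{m} \in \mathrm{dom}(f)$, then $$f(x_{m}) - f(x^{\ast}) \le K \alpha + K \lVert x^{\ast} - x_{0} \rVert \, \lVert d - d_{0} \rVert .$$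
   Context: $\mathbb{R}^{n}$ carries the Euclidean norm $\lVert \cdot \rVert$. The effective domain of $f$ is $\mathrm{dom}(f) = \{x : f(x) < \infty\}$. $K$-Lipschitz over $\mathrm{dom}(f)$ means $\lvert f(x) - f(y) \rvert \le K \lVert x - y \rVert$ for all $x,y \in \mathrm{dom}(f)$. A unique minimizer $x^{\ast}$ of $f$ means $f(x) > f(x^{\ast})$ for all $x \ne x^{\ast}$. *)

(* Defs.v *)
From mathcomp Require Import all_boot all_order all_algebra.
From mathcomp Require Import all_classical all_reals all_analysis.

Set Implicit Arguments.
Unset Strict Implicit.
Unset Printing Implicit Defensive.

Import Order.TTheory GRing.Theory Num.Theory.
Import numFieldNormedType.Exports.

Local Open Scope classical_set_scope.
Local Open Scope ring_scope.

(* R^n is 'rV[R]_n. The library norm on matrices is the sup norm, hence the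
   separate Euclidean norm; the library topology on 'rV[R]_n is the product
   topology, which is the usual topology of R^n, so [compact] can be used
   as is. *)
Definition enorm (R : realType) (n : nat) (x : 'rV[R]_n) : R :=
  Num.sqrt (\sum_(i < n) x ord0 i ^+ 2).

Definition edom (R : realType) (n : nat) (f : 'rV[R]_n -> \bar R) :
    set 'rV[R]_n :=
  [set x | (f x < +oo)%E].

Definition lipschitz_edom (R : realType) (n : nat) (K : R)
    (f : 'rV[R]_n -> \bar R) : Prop :=
  forall x y, edom f x -> edom f y ->
    (`|f x - f y| <= (K * enorm (x - y))%:E)%E.

Definition unique_minimizer (R : realType) (n : nat) (f : 'rV[R]_n -> \bar R)
    (xs : 'rV[R]_n) : Prop :=
  forall x, x != xs -> (f xs < f x)%E.

Definition edirection (R : realType) (n : nat) (x y : 'rV[R]_n) : 'rV[R]_n :=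
  (enorm (y - x))^-1 *: (y - x).

Definition iterate (R : realType) (n : nat) (x0 d : 'rV[R]_n) (alpha : R)
    (m : nat) : 'rV[R]_n :=
  x0 + (m%:R * alpha) *: d.

(* Main.v *)
Require Import Defs.
From mathcomp Require Import all_boot all_order all_algebra.
From mathcomp Require Import all_classical all_reals all_analysis.
From mathcomp Require Import ring lra.

Set Implicit Arguments.
Unset Strict Implicit.
Unset Printing Implicit Defensive.

Import Order.TTheory GRing.Theory Num.Theory.
Import numFieldNormedType.Exports.

Local Open Scope classical_set_scope.
Local Open Scope ring_scope.

(** Write [r] for the distance from [x0] to the minimizer [xs] and [d0] for the
    unit vector pointing from [x0] to [xs], so that [xs = x0 + r *: d0]. The
    [m]-th iterate has travelled a length [m * alpha] along [d] instead of [r]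
    along [d0], and its displacement from [xs] splits as
      [(m * alpha) *: (d - d0) - (r - m * alpha) *: d0].
    The choice of [m] as the floor of [r / alpha] says exactly that
    [m * alpha <= r < m * alpha + alpha]: the travelled length is at most [r],
    which bounds the first term by [r * enorm (d - d0)], and the rounding error
    is at most one step, which bounds the second by [alpha]
    ([enorm_iterate_le]). The Lipschitz condition, applied to this iterate
    and [xs], turns this distance bound into the bound on the values of [f]; that [K] is
    nonnegative comes from the Lipschitz condition at the distinct points [x0]
    and [xs] of the domain ([lipschitz_edom_ge0]). *)

Lemma enorm_ge0 (R : realType) n (x : 'rV[R]_n) : 0 <= enorm x.
Proof. exact: sqrtr_ge0. Qed.

Lemma sqr_enorm (R : realType) n (x : 'rV[R]_n) :
  enorm x ^+ 2 = \sum_(i < n) x ord0 i ^+ 2.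
Proof. by rewrite sqr_sqrtr// sumr_ge0// => i _; rewrite sqr_ge0. Qed.

Lemma enorm_eq0 (R : realType) n (x : 'rV[R]_n) : (enorm x == 0) = (x == 0).
Proof.
rewrite -(sqrf_eq0 (enorm x)) sqr_enorm psumr_eq0; last first.
  by move=> i _; exact: sqr_ge0.
apply/allP/eqP => [x0|-> i _]; last by rewrite mxE expr0n eqxx.
apply/rowP => i; rewrite mxE; apply/eqP; rewrite -sqrf_eq0.
by apply: x0; rewrite mem_index_enum.
Qed.

Lemma enormZ (R : realType) n (a : R) (x : 'rV[R]_n) :
  enorm (a *: x) = `|a| * enorm x.
Proof.
rewrite /enorm -sqrtr_sqr -sqrtrM ?sqr_ge0// mulr_sumr; congr (Num.sqrt _).
by apply: eq_bigr => i _; rewrite mxE exprMn.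
Qed.

(** With [a] and [b] the norms of [x] and [y], summing
    [0 <= (b * x i - a * y i) ^+ 2] over [i] gives
    [2 * a * b * <x, y> <= 2 * (a * b) ^+ 2], and [a * b] cancels unless one of
    the vectors vanishes, when both sides are [0]. *)
Lemma cauchy_schwarz_enorm (R : realType) n (x y : 'rV[R]_n) :
  \sum_(i < n) x ord0 i * y ord0 i <= enorm x * enorm y.
Proof.
have [->|x0] := eqVneq x 0.
  rewrite big1 ?mulr_ge0 ?enorm_ge0// => i _.
  by rewrite mxE mul0r.
have [->|y0] := eqVneq y 0.
  rewrite big1 ?mulr_ge0 ?enorm_ge0// => i _.
  by rewrite mxE mulr0.
have a_gt0 : 0 < enorm x by rewrite lt_def enorm_eq0 x0 enorm_ge0.
have b_gt0 : 0 < enorm y by rewrite lt_def enorm_eq0 y0 enorm_ge0.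
have : 0 <= \sum_(i < n) (enorm y * x ord0 i - enorm x * y ord0 i) ^+ 2.
  by apply: sumr_ge0 => i _; rewrite sqr_ge0.
rewrite (eq_bigr (fun i => enorm y ^+ 2 * x ord0 i ^+ 2
  + - (2 * (enorm x * enorm y)) * (x ord0 i * y ord0 i)
  + enorm x ^+ 2 * y ord0 i ^+ 2)); last by move=> i _; ring.
rewrite !big_split/= -!mulr_sumr -!sqr_enorm => le0.
by rewrite -(ler_pM2l (mulr_gt0 a_gt0 b_gt0)); lra.
Qed.

Lemma enorm_triangle (R : realType) n (x y : 'rV[R]_n) :
  enorm (x + y) <= enorm x + enorm y.
Proof.
rewrite -(@ler_pXn2r _ 2)// ?nnegrE ?addr_ge0 ?enorm_ge0//.
rewrite sqr_enorm (eq_bigr (fun i => x ord0 i ^+ 2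
  + 2 * (x ord0 i * y ord0 i) + y ord0 i ^+ 2)); last first.
  by move=> i _; rewrite mxE; ring.
rewrite !big_split/= -mulr_sumr -!sqr_enorm.
by have := cauchy_schwarz_enorm x y; nra.
Qed.

Lemma lipschitz_edom_ge0 (R : realType) n (K : R) (f : 'rV[R]_n -> \bar R) x y :
  lipschitz_edom K f -> edom f x -> edom f y -> x != y -> 0 <= K.
Proof.
move=> f_lip fx fy xy.
have r_gt0 : 0 < enorm (x - y) by rewrite lt_def enorm_eq0 subr_eq0 xy enorm_ge0.
rewrite -(pmulr_lge0 K r_gt0) -lee_fin.
exact: le_trans (abse_ge0 _) (f_lip _ _ fx fy).
Qed.

Lemma enorm_edirection (R : realType) n (x y : 'rV[R]_n) :
  x != y -> enorm (edirection x y) = 1.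
Proof.
move=> xy; rewrite enormZ ger0_norm ?invr_ge0 ?enorm_ge0// mulVf//.
by rewrite enorm_eq0 subr_eq0 eq_sym.
Qed.

(** The first term on the right is the rounding error in the travelled length,
    the second the drift caused by following [d] rather than the exact
    direction over a length at most [enorm (xs - x0)]. *)
Lemma enorm_iterate_le (R : realType) n (x0 xs d : 'rV[R]_n) (alpha : R) m :
  x0 != xs -> 0 < alpha -> m%:Z = Num.floor (enorm (xs - x0) / alpha) ->
  enorm (iterate x0 d alpha m - xs) <=
    alpha + enorm (xs - x0) * enorm (d - edirection x0 xs).
Proof.
move=> x0xs alpha_gt0 m_floor; set r := enorm (xs - x0).
set d0 := edirection x0 xs.
have r_neq0 : r != 0 by rewrite enorm_eq0 subr_eq0 eq_sym.
have len_le : m%:R * alpha <= r.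
  rewrite -ler_pdivlMr// -[m%:R]/((m%:Z)%:~R) m_floor.
  exact: floor_le.
have len_gt : r < m%:R * alpha + alpha.
  rewrite -[X in _ + X]mul1r -mulrDl -ltr_pdivrMr//.
  rewrite -[m%:R]/((m%:Z)%:~R) m_floor -[1]/(1%:~R) -intrD.
  exact: floorD1_gt.
have -> : iterate x0 d alpha m - xs =
    (m%:R * alpha - r) *: d0 + (m%:R * alpha) *: (d - d0).
  have -> : xs = x0 + r *: d0.
    by rewrite scalerA divff// scale1r addrC subrK.
  rewrite /iterate scalerBl scalerBr opprD addrACA subrr add0r.
  by rewrite [RHS]addrC addrA subrK.
apply: (le_trans (enorm_triangle _ _)).
rewrite (enormZ _ d0) (enormZ _ (d - d0)) (enorm_edirection x0xs) mulr1 lerD//.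
  by rewrite ler0_norm ?subr_le0//; lra.
by rewrite ger0_norm ?(mulr_ge0 _ (ltW alpha_gt0))// ler_wpM2r ?enorm_ge0.
Qed.

Theorem mainTheorem2 (R : realType) (n : nat) (K : R)
    (f : 'rV[R]_n -> \bar R)
    (f_gtNy : forall x, (-oo < f x)%E)
    (f_lip : lipschitz_edom K f)
    (f_cpt : compact (edom f))
    (xs : 'rV[R]_n) (xs_min : unique_minimizer f xs)
    (x0 : 'rV[R]_n) (x0_dom : edom f x0) (x0_neq : x0 != xs)
    (alpha : R) (alpha_gt0 : 0 < alpha)
    (d : 'rV[R]_n) (m : nat)
    (m_floor : m%:Z = Num.floor (enorm (xs - x0) / alpha))
    (xm_dom : edom f (iterate x0 d alpha m)) :
  (f (iterate x0 d alpha m) - f xs <=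
    (K * alpha + K * enorm (xs - x0) * enorm (d - edirection x0 xs))%:E)%E.
Proof.
have xs_dom : edom f xs.
  by apply: lt_trans x0_dom; apply: xs_min.
have K_ge0 : 0 <= K by apply: lipschitz_edom_ge0 f_lip x0_dom xs_dom x0_neq.
apply: (le_trans (lee_abs _)); apply: (le_trans (f_lip _ _ xm_dom xs_dom)).
by rewrite lee_fin -mulrA -mulrDr ler_wpM2l// enorm_iterate_le.
Qed.
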